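(* In a 2-$C^*$-category closed under projections, direct sums and conjugation, let $B\xleftarrow{\rho}A$, $C\xleftarrow{\rho'}B$, $C\xleftarrow{\sigma'}B$, $D\xleftarrow{\rho''}C$ be centrally balanced 1-arrows and let $T,T'\in\mathrm{Hom}(\rho',\sigma')$. (1) If $\omega\in S_l(\rho)$ and $\theta_\rho^{-1*}(\omega)\in S_l(\rho')$, then $(T\otimes1_\rho)_{|\omega}=(T'\otimes1_\rho)_{|\omega}$ if and only if $T_{|\theta_\rho^{-1*}(\omega)}=T'_{|\theta_\rho^{-1*}(\omega)}$. (2) If $\alpha\in S_l(\rho')$ and $\theta_{\rho'}^{-1*}(\alpha)\in S_l(\rho'')$, then $(1_{\rho''}\otimes T)_{|\alpha}=(1_{\rho''}\otimes T')_{|\alpha}$ if and only if $T_{|\alpha}=T'_{|\alpha}$.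
   Context: A 2-$C^*$-category is a strict 2-category (1-arrows $B\xleftarrow{\rho}A$ composed by $\otimes$, with unit 1-arrows $\iota_A$; 2-arrows $S\in\mathrm{Hom}(\rho,\sigma)$ between parallel 1-arrows, with vertical composition $\circ$, units $1_\rho$, and horizontal composition $\otimes$; $\mathrm{End}(\rho)=\mathrm{Hom}(\rho,\rho)$) such that every $\mathrm{Hom}(\rho,\sigma)$ is a complex Banach space, compositions are bilinear, there is an antilinear involution $*:\mathrm{Hom}(\rho,\sigma)\to\mathrm{Hom}(\sigma,\rho)$ with $(S\circ T)^*=T^*\circ S^*$ and $(S\otimes T)^*=S^*\otimes T^*$, $\|T\circ S\|\le\|T\|\|S\|$, $\|S^*\circ S\|=\|S\|^2$, and $S^*\circ S$ is positive. $\mathrm{End}(\iota_A)\cong C(\Omega_A)$, $\Omega_A$ compact Hausdorff. Projections split, direct sums exist (via isometries), and for each $B\xleftarrow{\rho}A$ there are a conjugate $A\xleftarrow{\bar\rho}B$ and a solution $R_\rho\in\mathrm{Hom}(\iota_A,\bar\rho\otimes\rho)$, $\bar R_\rho\in\mathrm{Hom}(\iota_B,\rho\otimes\bar\rho)$ of the conjugation equations $(\bar R_\rho^*\otimes1_\rho)\circ(1_\rho\otimes R_\rho)=1_\rho$, $(R_\rho^*\otimes1_{\bar\rho})\circ(1_{\bar\rho}\otimes\bar R_\rho)=1_{\bar\rho}$. Fibres: for $X,Y\in\mathrm{Hom}(\rho,\sigma)$ with source object $A$, put $\langle X,Y\rangle=R_\rho^*\circ(1_{\bar\rho}\otimes(Y^*\circ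 X))\circ R_\rho\in C(\Omega_A)$; $X_{|\omega}$ denotes the image of $X$ in the separated completion of $\mathrm{Hom}(\rho,\sigma)$ for $\langle\cdot,\cdot\rangle(\omega)$, so $X_{|\omega}=Y_{|\omega}$ iff $\langle X-Y,X-Y\rangle(\omega)=0$. For products one uses the product solution $R_{\rho'\otimes\rho}=(1_{\bar\rho}\otimes R_{\rho'}\otimes1_\rho)\circ R_\rho$, $\bar R_{\rho'\otimes\rho}=(1_{\rho'}\otimes\bar R_\rho\otimes1_{\bar\rho'})\circ\bar R_{\rho'}$ (the equality relation on fibres does not depend on the solution). $\rho$ is centrally balanced if $\mathrm{End}(\iota_B)\otimes1_\rho=1_\rho\otimes\mathrm{End}(\iota_A)$. $S_l(\rho)\subset\Omega_A$ and $S_r(\rho)\subset\Omega_B$ are the closed subsets corresponding to the kernels of $w\mapsto1_\rho\otimes w$ ($w\in\mathrm{End}(\iota_A)$) and $z\mapsto z\otimes1_\rho$ ($z\in\mathrm{End}(\iota_B)$), i.e. the common zero sets of these kernels; they are clopen and equal the supports of $R_\rho^*\circ R_\rho$ and $\bar R_\rho^*\circ\bar R_\rho$. For centrally balanced $\rho$, $\theta_\rho:C(S_l(\rho))\to C(S_r(\rho))$ is the isomorphism determined by $\theta_\rho(w)\otimes1_\rho=1_\rho\otimes w$ (functions on the clopen sets being extended by $0$), and $\theta_\rho^{-1*}:S_l(\rho)\to S_r(\rho)$ is the homeomorphism with $\theta_\rho(w)(\theta_\rho^{-1*}(\omega))=w(\omega)$. *)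

(* Defs.v *)
From HB Require Import structures.
From mathcomp Require Import all_boot all_order all_algebra complex.
From mathcomp Require Import all_classical all_reals all_analysis.

Set Implicit Arguments.
Unset Strict Implicit.
Unset Printing Implicit Defensive.

Import Order.TTheory GRing.Theory Num.Theory.
Import numFieldNormedType.Exports.

Local Open Scope classical_set_scope.
Local Open Scope ring_scope.

Declare Scope twocat_scope.
Delimit Scope twocat_scope with T2.
Local Open Scope twocat_scope.

(* [arr A B] is the type of 1-arrows B <- A, so that [tens1 s r] (s after r)
   is the composite written s \otimes r. *)
Record twocat_data (R : realType) := TwoCatData {
  obj : Type;
  arr : obj -> obj -> Type;
  hom2 : forall A B : obj, arr A B -> arr A B -> completeNormedModType R[i];
  unit1 : forall A : obj, arr A A;
  tens1 : forall A B C : obj, arr B C -> arr A B -> arr A C;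
  unit1l : forall (A B : obj) (r : arr A B), tens1 (unit1 B) r = r;
  unit1r : forall (A B : obj) (r : arr A B), tens1 r (unit1 A) = r;
  tens1A : forall (A B C D : obj) (t : arr C D) (s : arr B C) (r : arr A B),
    tens1 t (tens1 s r) = tens1 (tens1 t s) r;
  id2 : forall (A B : obj) (r : arr A B), hom2 r r;
  comp2 : forall (A B : obj) (r s t : arr A B),
    hom2 s t -> hom2 r s -> hom2 r t;
  tens2 : forall (A B C : obj) (s s' : arr B C) (r r' : arr A B),
    hom2 s s' -> hom2 r r' -> hom2 (tens1 s r) (tens1 s' r');
  star2 : forall (A B : obj) (r s : arr A B), hom2 r s -> hom2 s r
}.
Arguments arr {R _} A B.
Arguments hom2 {R _ A B} r s.
Arguments unit1 {R _} A.
Arguments tens1 {R _ A B C} s r : rename.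
Arguments unit1l {R _ A B} r.
Arguments unit1r {R _ A B} r.
Arguments tens1A {R _ A B C D} _ _ _.
Arguments id2 {R _ A B} r.
Arguments comp2 {R _ A B r s _} _ _.
Arguments tens2 {R _ A B C s s' r r'} _ _.
Arguments star2 {R _ A B r s} _.

Notation "s ** r" := (tens1 s r) (at level 40, left associativity)
  : twocat_scope.
Notation "T *** S" := (tens2 T S) (at level 40, left associativity)
  : twocat_scope.
Notation "T \c S" := (comp2 T S) (at level 45, left associativity)
  : twocat_scope.

(* Composition of 1-arrows is strictly associative and unital, but only up to
   propositional equality; [cast2] is transport of 2-arrows along equalities of
   their source and target. *)
Definition cast2 (R : realType) (K : twocat_data R) (A B : obj K)
    (r r' s s' : arr A B) (er : r = r') (es : s = s') (X : hom2 r s) :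
    hom2 r' s' :=
  ecast t (hom2 r' t) es (ecast t (hom2 t s) er X).

Definition spectrum2 (R : realType) (K : twocat_data R) (A B : obj K)
    (r : arr A B) (X : hom2 r r) : set R[i] :=
  [set l | ~ exists Y : hom2 r r,
     (X - l *: id2 r) \c Y = id2 r /\ Y \c (X - l *: id2 r) = id2 r].

(* In the order of [R[i]], [0 <= l] says that l is real and nonnegative. *)
Definition positive2 (R : realType) (K : twocat_data R) (A B : obj K)
    (r : arr A B) (X : hom2 r r) : Prop :=
  star2 X = X /\ forall l, spectrum2 X l -> 0 <= l.

Record is_cstar2cat (R : realType) (K : twocat_data R) : Prop := IsCStar2Cat {
  comp2A : forall (A B : obj K) (r s t u : arr A B)
    (X : hom2 t u) (Y : hom2 s t) (Z : hom2 r s), X \c (Y \c Z) = X \c Y \c Z;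
  comp2_1l : forall (A B : obj K) (r s : arr A B) (X : hom2 r s),
    id2 s \c X = X;
  comp2_1r : forall (A B : obj K) (r s : arr A B) (X : hom2 r s),
    X \c id2 r = X;
  tens2A : forall (A B C D : obj K) (t t' : arr C D) (s s' : arr B C)
    (r r' : arr A B) (X : hom2 t t') (Y : hom2 s s') (Z : hom2 r r'),
    cast2 (tens1A t s r) (tens1A t' s' r') (X *** (Y *** Z)) = X *** Y *** Z;
  tens2_1l : forall (A B : obj K) (r s : arr A B) (X : hom2 r s),
    cast2 (unit1l r) (unit1l s) (id2 (unit1 B) *** X) = X;
  tens2_1r : forall (A B : obj K) (r s : arr A B) (X : hom2 r s),
    cast2 (unit1r r) (unit1r s) (X *** id2 (unit1 A)) = X;
  tens2_id : forall (A B C : obj K) (s : arr B C) (r : arr A B),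
    id2 s *** id2 r = id2 (s ** r);
  interchange : forall (A B C : obj K) (s s' s'' : arr B C)
    (r r' r'' : arr A B) (X : hom2 s' s'') (Y : hom2 s s')
    (Z : hom2 r' r'') (W : hom2 r r'),
    (X \c Y) *** (Z \c W) = (X *** Z) \c (Y *** W);
  comp2_linearl : forall (A B : obj K) (r s t : arr A B) (Y : hom2 r s),
    linear (fun X : hom2 s t => X \c Y);
  comp2_linearr : forall (A B : obj K) (r s t : arr A B) (X : hom2 s t),
    linear (fun Y : hom2 r s => X \c Y);
  tens2_linearl : forall (A B C : obj K) (s s' : arr B C) (r r' : arr A B)
    (Y : hom2 r r'), linear (fun X : hom2 s s' => X *** Y);
  tens2_linearr : forall (A B C : obj K) (s s' : arr B C) (r r' : arr A B)
    (X : hom2 s s'), linear (fun Y : hom2 r r' => X *** Y);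
  star2_antilinear : forall (A B : obj K) (r s : arr A B) (a : R[i])
    (X Y : hom2 r s), star2 (a *: X + Y) = a^* *: star2 X + star2 Y;
  star2K : forall (A B : obj K) (r s : arr A B) (X : hom2 r s),
    star2 (star2 X) = X;
  star2_comp : forall (A B : obj K) (r s t : arr A B)
    (X : hom2 s t) (Y : hom2 r s), star2 (X \c Y) = star2 Y \c star2 X;
  star2_tens : forall (A B C : obj K) (s s' : arr B C) (r r' : arr A B)
    (X : hom2 s s') (Y : hom2 r r'), star2 (X *** Y) = star2 X *** star2 Y;
  norm_comp2 : forall (A B : obj K) (r s t : arr A B)
    (X : hom2 s t) (Y : hom2 r s), `|X \c Y| <= `|X| * `|Y|;
  norm_cstar : forall (A B : obj K) (r s : arr A B) (X : hom2 r s),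
    `|star2 X \c X| = `|X| ^+ 2;
  positive_cstar : forall (A B : obj K) (r s : arr A B) (X : hom2 r s),
    positive2 (star2 X \c X)
}.

Record cstar2cat (R : realType) := CStar2Cat {
  cstar2cat_data :> twocat_data R;
  cstar2catP : is_cstar2cat cstar2cat_data
}.

Definition projections_split (R : realType) (K : twocat_data R) : Prop :=
  forall (A B : obj K) (r : arr A B) (P : hom2 r r),
    P \c P = P -> star2 P = P ->
  exists (s : arr A B) (V : hom2 s r),
    star2 V \c V = id2 s /\ V \c star2 V = P.

Definition direct_sums_exist (R : realType) (K : twocat_data R) : Prop :=
  forall (A B : obj K) (r s : arr A B),
  exists (t : arr A B) (V : hom2 r t) (W : hom2 s t),
    [/\ star2 V \c V = id2 r, star2 W \c W = id2 s
      & V \c star2 V + W \c star2 W = id2 t].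

Record conj_data (R : realType) (K : twocat_data R) (A B : obj K)
    (r : arr A B) := ConjData {
  conj1 : arr B A;
  conjR : hom2 (unit1 A) (conj1 ** r);
  conjRbar : hom2 (unit1 B) (r ** conj1)
}.

Definition conj_solution (R : realType) (K : twocat_data R) (A B : obj K)
    (r : arr A B) (c : conj_data r) : Prop :=
  cast2 (esym (tens1A r (conj1 c) r)) (unit1l r)
      (star2 (conjRbar c) *** id2 r)
    \c cast2 (unit1r r) erefl (id2 r *** conjR c) = id2 r
  /\
  cast2 (esym (tens1A (conj1 c) r (conj1 c))) (unit1l (conj1 c))
      (star2 (conjR c) *** id2 (conj1 c))
    \c cast2 (unit1r (conj1 c)) erefl (id2 (conj1 c) *** conjRbar c)
  = id2 (conj1 c).

Definition conjugates_exist (R : realType) (K : twocat_data R) : Prop :=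
  forall (A B : obj K) (r : arr A B), exists c : conj_data r, conj_solution c.

(* The product solution for s \otimes r; the conjugate is
   conj1 c \otimes conj1 d. *)
Definition conj_prod (R : realType) (K : twocat_data R) (A B C : obj K)
    (s : arr B C) (r : arr A B) (d : conj_data s) (c : conj_data r) :
    conj_data (s ** r) :=
  @ConjData R K A C (s ** r) (conj1 c ** conj1 d)
    (cast2 erefl (tens1A (conj1 c) (conj1 d) (s ** r))
       (id2 (conj1 c) ***
          cast2 (unit1l r) (esym (tens1A (conj1 d) s r)) (conjR d *** id2 r))
     \c conjR c)
    (cast2 erefl (tens1A s r (conj1 c ** conj1 d))
       (id2 s ***
          cast2 (unit1l (conj1 d)) (esym (tens1A r (conj1 c) (conj1 d)))
            (conjRbar c *** id2 (conj1 d)))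
     \c conjRbar d).

(* Identification of the algebras End(iota_A) with C(Omega_A), Omega_A compact
   Hausdorff: [ev w] is the function corresponding to w.  An isomorphism of
   C*-algebras is isometric for the supremum norm; this is [ev_norm].  [R[i]^o]
   is [R[i]] with its norm topology. *)
Record gelfand (R : realType) (K : twocat_data R) := Gelfand {
  Omega : obj K -> topologicalType;
  Omega_compact : forall A, compact [set: Omega A];
  Omega_hausdorff : forall A, hausdorff_space (Omega A);
  ev : forall A, hom2 (unit1 A) (unit1 A) -> Omega A -> R[i]^o;
  ev_continuous : forall A (w : hom2 (unit1 A) (unit1 A)), continuous (ev w);
  ev_surj : forall A (f : Omega A -> R[i]^o), continuous f ->
    exists w : hom2 (unit1 A) (unit1 A), ev w = f;
  ev_linear : forall A (a : R[i]) (v w : hom2 (unit1 A) (unit1 A)) x,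
    ev (a *: v + w) x = a * ev v x + ev w x;
  ev_mul : forall A (v w : hom2 (unit1 A) (unit1 A)) x,
    ev (v \c w) x = ev v x * ev w x;
  ev_one : forall A x, ev (id2 (unit1 A)) x = 1;
  ev_star : forall A (w : hom2 (unit1 A) (unit1 A)) x,
    ev (star2 w) x = (ev w x)^*;
  ev_norm : forall A (w : hom2 (unit1 A) (unit1 A)) (M : R[i]), 0 <= M ->
    (`|w| <= M <-> forall x, `|ev w x| <= M)
}.
Arguments Omega {R K} g A.
Arguments ev {R K} g {A} w x.

(* Separated completion of [V] for a seminorm [p], as classes of Cauchy
   sequences. *)
Definition cauchy_seq (F : numDomainType) (V : zmodType) (p : V -> F)
    (u : nat -> V) : Prop :=
  forall e, 0 < e -> exists N, forall m n, (N <= m)%N -> (N <= n)%N ->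
    p (u m - u n) < e.

Definition cauchy_class (F : numDomainType) (V : zmodType) (p : V -> F)
    (u : nat -> V) : set (nat -> V) :=
  [set v | cauchy_seq p v /\
     forall e, 0 < e -> exists N, forall n, (N <= n)%N -> p (u n - v n) < e].

Record sep_completion (F : numDomainType) (V : zmodType) (p : V -> F) :=
  SepCompletion {
    sep_class : set (nat -> V);
    sep_classP : exists2 u, cauchy_seq p u & sep_class = cauchy_class p u
  }.

Lemma cauchy_seq_cst (F : numDomainType) (V : zmodType) (p : V -> F)
  (p0 : p 0 = 0) (x : V) : cauchy_seq p (fun=> x).
Proof. by move=> e e0; exists 0%N => m n _ _; rewrite subrr p0. Qed.

Definition sep_image (F : numDomainType) (V : zmodType) (p : V -> F)
    (p0 : p 0 = 0) (x : V) : sep_completion p :=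
  SepCompletion (ex_intro2 _ _ _ (cauchy_seq_cst p0 x) erefl).

Definition bracket (R : realType) (K : twocat_data R) (A B : obj K)
    (r s : arr A B) (c : conj_data r) (X Y : hom2 r s) :
    hom2 (unit1 A) (unit1 A) :=
  star2 (conjR c) \c (id2 (conj1 c) *** (star2 Y \c X)) \c conjR c.

Definition fibre_seminorm (R : realType) (K : twocat_data R) (G : gelfand K)
    (A B : obj K) (r s : arr A B) (c : conj_data r) (x : Omega G A)
    (X : hom2 r s) : R[i] :=
  sqrtC (ev G (bracket c X X) x).

Lemma fibre_seminorm0 (R : realType) (K : cstar2cat R) (G : gelfand K)
    (A B : obj K) (r s : arr A B) (c : conj_data r) (x : Omega G A) :
  fibre_seminorm c x (0 : hom2 r s) = 0.
Proof.
have H := cstar2catP K.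
have lin0 (U V : lmodType R[i]) (f : U -> V) : linear f -> f 0 = 0.
  by move=> fl; have := fl (-1) 0 0; rewrite scaler0 addr0 scaleN1r addNr.
rewrite /fibre_seminorm /bracket.
rewrite (lin0 _ _ _ (comp2_linearr H (star2 (0 : hom2 r s)))).
rewrite (lin0 _ _ _ (tens2_linearr H (id2 (conj1 c)))).
rewrite (lin0 _ _ _ (comp2_linearr H (star2 (conjR c)))).
rewrite (lin0 _ _ _ (comp2_linearl H (conjR c))).
have := ev_linear (-1) (0 : hom2 (unit1 A) (unit1 A)) 0 x.
by rewrite scaler0 addr0 mulN1r addNr => ->; rewrite sqrtC0.
Qed.

(* [fibre c x X] is X_{|x}, computed with the solution [c] for the source of
   X. *)
Definition fibre (R : realType) (K : cstar2cat R) (G : gelfand K)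
    (A B : obj K) (r s : arr A B) (c : conj_data r) (x : Omega G A)
    (X : hom2 r s) : sep_completion (@fibre_seminorm R K G A B r s c x) :=
  sep_image (@fibre_seminorm0 R K G A B r s c x) X.

(* z \otimes 1_r and 1_r \otimes w, as elements of End(r). *)
Definition lact (R : realType) (K : twocat_data R) (A B : obj K)
    (r : arr A B) (z : hom2 (unit1 B) (unit1 B)) : hom2 r r :=
  cast2 (unit1l r) (unit1l r) (z *** id2 r).

Definition ract (R : realType) (K : twocat_data R) (A B : obj K)
    (r : arr A B) (w : hom2 (unit1 A) (unit1 A)) : hom2 r r :=
  cast2 (unit1r r) (unit1r r) (id2 r *** w).

Definition centrally_balanced (R : realType) (K : twocat_data R)
    (A B : obj K) (r : arr A B) : Prop :=
  range (lact r) = range (ract r).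

Definition Sl (R : realType) (K : twocat_data R) (G : gelfand K)
    (A B : obj K) (r : arr A B) : set (Omega G A) :=
  [set x | forall w, ract r w = 0 -> ev G w x = 0].

Definition Sr (R : realType) (K : twocat_data R) (G : gelfand K)
    (A B : obj K) (r : arr A B) : set (Omega G B) :=
  [set y | forall z, lact r z = 0 -> ev G z y = 0].

Arguments Sl {R K} G {A B} r.
Arguments Sr {R K} G {A B} r.

(* For S clopen, C(S) is encoded, through extension by 0, as the set of those
   w in End(iota_A) = C(Omega_A) that vanish off S. *)
Definition supported (R : realType) (K : twocat_data R) (G : gelfand K)
    (A : obj K) (S : set (Omega G A)) : set (hom2 (unit1 A) (unit1 A)) :=
  [set w | forall x, ~ S x -> ev G w x = 0].

(* Meaningful on [supported (Sl G r)], with values in [supported (Sr G r)],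
   for r centrally balanced; [xget] selects the unique such z. *)
Definition theta (R : realType) (K : twocat_data R) (G : gelfand K)
    (A B : obj K) (r : arr A B) (w : hom2 (unit1 A) (unit1 A)) :
    hom2 (unit1 B) (unit1 B) :=
  xget 0 [set z | supported (Sr G r) z /\ lact r z = ract r w].

(* [h] is the homeomorphism theta_r^{-1*} : S_l(r) -> S_r(r).  Sets coerce to
   their subtypes, equipped with the subspace topology. *)
Definition is_theta_inv_star (R : realType) (K : twocat_data R)
    (G : gelfand K) (A B : obj K) (r : arr A B) (h : Sl G r -> Sr G r) :
    Prop :=
  [/\ continuous h,
      exists2 g : Sr G r -> Sl G r,
        cancel h g /\ cancel g h & continuous g
    & forall w, supported (Sl G r) w ->
        forall x : Sl G r, ev G (theta G r w) (val (h x)) = ev G w (val x)].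

(* Main.v *)
Require Import Defs.
From HB Require Import structures.
From mathcomp Require Import all_boot all_order all_algebra complex.
From mathcomp Require Import all_classical all_reals all_analysis.

Set Implicit Arguments.
Unset Strict Implicit.
Unset Printing Implicit Defensive.

Import Order.TTheory GRing.Theory Num.Theory.
Import numFieldNormedType.Exports.

Local Open Scope classical_set_scope.
Local Open Scope ring_scope.
Local Open Scope twocat_scope.

(* Write Tr_c X = R^* (1 \otimes X) R.  For the product solution,
   Tr (U \otimes V) = Tr_c ((Tr_d U \otimes 1) V), and a factor
   1_r \otimes w comes out of Tr_c.  Since rho is centrally balanced,
   <T,T> \otimes 1 = 1 \otimes w, where w is <T,T> transported along
   theta_rho^{-1*}; hence the squared seminorm of T \otimes 1 at omega is
   (R^* R)(omega) <T,T>(theta_rho^{-1*} omega).  In the same way that of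
   1 \otimes T at alpha is <T,T>(alpha) (R''^* R'')(theta_rho'^{-1*} alpha).
   The first factor, resp. the second one, is nonzero because S_l is the set
   where R^* R does not vanish. *)

(* Equality of 2-arrows whose ends are only propositionally equal; it absorbs
   all the transports [cast2]. *)
Definition heq (R : realType) (K : twocat_data R) (A B : obj K)
    (r s r' s' : arr A B) (X : hom2 r s) (Y : hom2 r' s') : Prop :=
  exists (er : r = r') (es : s = s'), cast2 er es X = Y.
Notation "X =~ Y" := (heq X Y) (at level 70, no associativity).

(** * 2-arrows up to transport, the two central actions, and partial traces *)

Section Heq.
Context (R : realType) (K : cstar2cat R).
Implicit Types A B C : obj K.

Lemma heq_refl A B (r s : arr A B) (X : hom2 r s) : X =~ X.
Proof. by exists erefl, erefl. Qed.

Lemma heq_sym A B (r s r' s' : arr A B) (X : hom2 r s) (Y : hom2 r' s') :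
  X =~ Y -> Y =~ X.
Proof. by case=> er [es <-]; case: _ / er; case: _ / es; exact: heq_refl. Qed.

Lemma heq_trans A B (r s r' s' r'' s'' : arr A B) (X : hom2 r s)
    (Y : hom2 r' s') (Z : hom2 r'' s'') : X =~ Y -> Y =~ Z -> X =~ Z.
Proof. by case=> er [es <-]; case: _ / er; case: _ / es. Qed.

(** Equality proofs between 1-arrows are irrelevant, so transport along a loop is the identity. *)
Lemma heq_eq A B (r s : arr A B) (X Y : hom2 r s) : X =~ Y -> X = Y.
Proof.
case=> er [es <-]; rewrite (Prop_irrelevance er erefl).
by rewrite (Prop_irrelevance es erefl).
Qed.

Lemma heq_cast A B (r s r' s' r0 s0 : arr A B) (er : r = r') (es : s = s')
  (X : hom2 r s) (Y : hom2 r0 s0) : X =~ Y -> cast2 er es X =~ Y.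
Proof. by case: _ / er; case: _ / es. Qed.

Lemma heq_comp A B (r s t r' s' t' : arr A B) (X : hom2 s t) (Y : hom2 r s)
    (X' : hom2 s' t') (Y' : hom2 r' s') :
  X =~ X' -> Y =~ Y' -> X \c Y =~ X' \c Y'.
Proof.
case=> es [et <-]; case: _ / es Y'; case: _ / et => Y'.
case=> er [es <-]; rewrite (Prop_irrelevance es erefl).
by case: _ / er; exact: heq_refl.
Qed.

Lemma heq_tens A B C (s s' s1 s1' : arr B C) (r r' r1 r1' : arr A B)
    (X : hom2 s s') (X1 : hom2 s1 s1') (Y : hom2 r r') (Y1 : hom2 r1 r1') :
  X =~ X1 -> Y =~ Y1 -> X *** Y =~ X1 *** Y1.
Proof.
case=> es [et <-]; case: _ / es; case: _ / et.
by case=> es [et <-]; case: _ / es; case: _ / et; exact: heq_refl.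
Qed.

Lemma heq_star A B (r s r' s' : arr A B) (X : hom2 r s) (Y : hom2 r' s') :
  X =~ Y -> star2 X =~ star2 Y.
Proof. by case=> er [es <-]; case: _ / er; case: _ / es; exact: heq_refl. Qed.

Let H := cstar2catP K.

Lemma heq_tensA A B C D (t t' : arr C D) (s s' : arr B C)
    (r r' : arr A B) (X : hom2 t t') (Y : hom2 s s') (Z : hom2 r r') :
  X *** (Y *** Z) =~ X *** Y *** Z.
Proof. by rewrite -(tens2A H); apply/heq_sym/heq_cast/heq_refl. Qed.

Lemma heq_1tens A B (r s : arr A B) (X : hom2 r s) :
  id2 (unit1 B) *** X =~ X.
Proof.
by rewrite -[X in _ =~ X](tens2_1l H); apply/heq_sym/heq_cast/heq_refl.
Qed.

Lemma heq_tens1 A B (r s : arr A B) (X : hom2 r s) :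
  X *** id2 (unit1 A) =~ X.
Proof.
by rewrite -[X in _ =~ X](tens2_1r H); apply/heq_sym/heq_cast/heq_refl.
Qed.

Lemma lact_heq A B (r : arr A B) z : lact r z =~ z *** id2 r.
Proof. exact/heq_cast/heq_refl. Qed.

Lemma ract_heq A B (r : arr A B) w : ract r w =~ id2 r *** w.
Proof. exact/heq_cast/heq_refl. Qed.

Lemma star_id2 A B (r : arr A B) : star2 (id2 r) = id2 r.
Proof.
have := congr1 star2 (comp2_1r H (star2 (id2 r))).
by rewrite (star2_comp H) (star2K H) (comp2_1r H).
Qed.

Lemma star_tens1 A B C (s s' : arr B C) (r : arr A B) (T : hom2 s s') :
  star2 (T *** id2 r) \c (T *** id2 r) = (star2 T \c T) *** id2 r.
Proof.
by rewrite (star2_tens H) star_id2 -(Defs.interchange H) (comp2_1l H).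
Qed.

Lemma star_1tens A B C (s : arr B C) (r r' : arr A B) (T : hom2 r r') :
  star2 (id2 s *** T) \c (id2 s *** T) = id2 s *** (star2 T \c T).
Proof.
by rewrite (star2_tens H) star_id2 -(Defs.interchange H) (comp2_1l H).
Qed.

(** The interchange law factors z \otimes Y both as (z \otimes 1)(1 \otimes Y) and as (1 \otimes
    Y)(z \otimes 1). *)
Lemma lact_nat A B (r s : arr A B) (Y : hom2 r s) z :
  lact s z \c Y = Y \c lact r z.
Proof.
apply: heq_eq.
have e : lact s z \c Y =~ (z *** id2 s) \c (id2 (unit1 B) *** Y).
  by apply: heq_comp; [exact: lact_heq | exact/heq_sym/heq_1tens].
apply: heq_trans e _.
rewrite -(Defs.interchange H) (comp2_1l H) (comp2_1r H).
rewrite -{1}(comp2_1l H z) -{1}(comp2_1r H Y) (Defs.interchange H).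
by apply: heq_comp; [exact: heq_1tens | exact/heq_sym/lact_heq].
Qed.

Lemma ract_nat A B (r s : arr A B) (Y : hom2 r s) w :
  ract s w \c Y = Y \c ract r w.
Proof.
apply: heq_eq.
have e : ract s w \c Y =~ (id2 s *** w) \c (Y *** id2 (unit1 A)).
  by apply: heq_comp; [exact: ract_heq | exact/heq_sym/heq_tens1].
apply: heq_trans e _.
rewrite -(Defs.interchange H) (comp2_1l H) (comp2_1r H).
rewrite -{1}(comp2_1l H w) -{1}(comp2_1r H Y) (Defs.interchange H).
by apply: heq_comp; [exact: heq_tens1 | exact/heq_sym/ract_heq].
Qed.

Lemma lact_unit A (w : hom2 (unit1 A) (unit1 A)) : lact (unit1 A) w = w.
Proof. by apply: heq_eq; apply: heq_trans (lact_heq _ _) (heq_tens1 _). Qed.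

Lemma ract_unit A (w : hom2 (unit1 A) (unit1 A)) : ract (unit1 A) w = w.
Proof. by apply: heq_eq; apply: heq_trans (ract_heq _ _) (heq_1tens _). Qed.

Lemma lact_tens A B C (s : arr B C) (r : arr A B) z :
  lact (s ** r) z = lact s z *** id2 r.
Proof.
apply: heq_eq; apply: heq_trans (lact_heq _ _) _.
rewrite -(tens2_id H); apply: heq_trans (heq_tensA _ _ _) _.
by apply: heq_tens (heq_refl _); exact/heq_sym/lact_heq.
Qed.

Lemma ract_tens A B C (s : arr B C) (r : arr A B) w :
  ract (s ** r) w = id2 s *** ract r w.
Proof.
apply: heq_eq; apply: heq_trans (ract_heq _ _) _.
rewrite -(tens2_id H); apply: heq_trans (heq_sym (heq_tensA _ _ _)) _.
by apply: heq_tens (heq_refl _) _; exact/heq_sym/ract_heq.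
Qed.

Definition ctrace A B (r : arr A B) (c : conj_data r) (X : hom2 r r) :
    hom2 (unit1 A) (unit1 A) :=
  star2 (conjR c) \c (id2 (conj1 c) *** X) \c conjR c.

Lemma bracketE A B (r s : arr A B) (c : conj_data r) (X Y : hom2 r s) :
  bracket c X Y = ctrace c (star2 Y \c X).
Proof. by []. Qed.

(** By [ract_tens], w acts on the right of [conj1 c ** r]; [ract_nat] slides it through [conjR c] to
    the unit 1-arrow, where it acts as itself. *)
Lemma ctrace_ract A B (r : arr A B) (c : conj_data r) (X : hom2 r r) w :
  ctrace c (X \c ract r w) = ctrace c X \c w.
Proof.
rewrite /ctrace -(comp2_1l H (id2 (conj1 c))) (Defs.interchange H) -ract_tens.
by rewrite (comp2_1l H) -!(comp2A H) ract_nat ract_unit.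
Qed.

Lemma ctrace_id A B (r : arr A B) (c : conj_data r) :
  ctrace c (id2 r) = star2 (conjR c) \c conjR c.
Proof. by rewrite /ctrace (tens2_id H) (comp2_1r H). Qed.

(** The [conjR] of the product solution is that of [c] with that of [d] inserted in the middle. The
    inner one closes U to the scalar z = [ctrace d U], and interchange splits z \otimes V. *)
Lemma ctrace_prod A B C (s : arr B C) (r : arr A B) (d : conj_data s)
    (c : conj_data r) (U : hom2 s s) (V : hom2 r r) :
  ctrace (conj_prod d c) (U *** V) = ctrace c (lact r (ctrace d U) \c V).
Proof.
rewrite /ctrace /= (star2_comp H) -!(comp2A H); congr (_ \c _).
rewrite !(comp2A H); congr (_ \c _); apply: heq_eq.
set M := cast2 erefl _ _.
have M1 : M =~ id2 (conj1 c) *** (conjR d *** id2 r).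
  apply: heq_cast; apply: heq_tens (heq_refl _) _.
  exact/heq_cast/heq_refl.
have N1 : id2 (conj1 c ** conj1 d) *** (U *** V) =~
    id2 (conj1 c) *** (id2 (conj1 d) *** U *** V).
  rewrite -(tens2_id H); apply: heq_trans (heq_sym (heq_tensA _ _ _)) _.
  exact/(heq_tens (heq_refl _))/heq_tensA.
apply: heq_trans (heq_comp (heq_comp (heq_star M1) N1) M1) _.
rewrite !(star2_tens H) !star_id2 -!(Defs.interchange H).
rewrite !(comp2_1l H) (comp2_1r H).
apply: heq_tens (heq_refl _) _.
move: (_ \c conjR d) => z.
rewrite -{1}(comp2_1r H z) -{1}(comp2_1l H V) (Defs.interchange H).
exact: heq_comp (heq_sym (lact_heq _ _)) (heq_1tens _).
Qed.
End Heq.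

Section LinearMaps.
Context (F : pzRingType) (U V : lmodType F) (f : U -> V) (fl : linear f).

Lemma linear_zero : f 0 = 0.
Proof. by have := fl (-1) 0 0; rewrite scaler0 addr0 scaleN1r addNr. Qed.

Lemma linear_add x y : f (x + y) = f x + f y.
Proof. by have := fl 1 x y; rewrite !scale1r. Qed.

Lemma linear_scale a x : f (a *: x) = a *: f x.
Proof. by have := fl a x 0; rewrite !addr0 linear_zero addr0. Qed.

Lemma linear_sub x y : f (x - y) = f x - f y.
Proof. by rewrite -!scaleN1r addrC fl addrC. Qed.
End LinearMaps.

(** * Evaluation of scalars, and the positive form that defines the fibres *)

Section Gelfand.
Context (R : realType) (K : cstar2cat R) (G : gelfand K).
Let H := cstar2catP K.

Lemma ev_is_linear A (x : Omega G A) : linear (fun w => ev G w x).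
Proof. by move=> a v w; rewrite ev_linear. Qed.

Lemma evB A (v w : hom2 (unit1 A) (unit1 A)) x :
  ev G (v - w) x = ev G v x - ev G w x.
Proof. exact: (linear_sub (@ev_is_linear A x)). Qed.

Lemma evD A (v w : hom2 (unit1 A) (unit1 A)) x :
  ev G (v + w) x = ev G v x + ev G w x.
Proof. exact: (linear_add (@ev_is_linear A x)). Qed.

Lemma evZ A a (w : hom2 (unit1 A) (unit1 A)) x :
  ev G (a *: w) x = a * ev G w x.
Proof. exact: (linear_scale (@ev_is_linear A x)). Qed.

(** Isometry of the Gelfand transform, [ev_norm], used with bound 0. *)
Lemma ev_inj A (v w : hom2 (unit1 A) (unit1 A)) : ev G v =1 ev G w -> v = w.
Proof.
move=> vw; apply/eqP; rewrite -subr_eq0 -normr_le0; apply/(ev_norm G) => // x.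
by rewrite evB vw subrr normr0.
Qed.

(** The value at x lies in the spectrum: an inverse of the element minus its value would, evaluated
    at x, give 0 = 1. *)
Lemma ev_star_ge0 A (s : arr A A) (Y : hom2 (unit1 A) s) x :
  0 <= ev G (star2 Y \c Y) x.
Proof.
have [_] := positive_cstar H Y; apply => -[Z [YZ _]].
have /eqP := congr1 (fun w => ev G w x) YZ.
by rewrite ev_mul evB evZ !ev_one mulr1 subrr mul0r eq_sym oner_eq0.
Qed.

Section Fibre.
Context (A B : obj K) (r s : arr A B) (c : conj_data r) (x : Omega G A).
Implicit Types X Y Z : hom2 r s.

Let b X Y := ev G (bracket c X Y) x.

Lemma star2D X Y : star2 (X + Y) = star2 X + star2 Y.
Proof.
by have := star2_antilinear H 1 X Y; rewrite !scale1r conjC1 scale1r.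
Qed.

Lemma star2Z (a : R[i]) X : star2 (a *: X) = a^* *: star2 X.
Proof.
have s0 : star2 (0 : hom2 r s) = 0.
  have := star2_antilinear H (-1) (0 : hom2 r s) 0.
  by rewrite scaler0 addr0 rmorphN1 scaleN1r addNr.
by have := star2_antilinear H a X 0; rewrite s0 !addr0.
Qed.

Lemma bracket_linearl Y : linear (fun X => b X Y : R[i]^o).
Proof.
move=> a X Z; rewrite /b /bracket (comp2_linearr H) (tens2_linearr H).
by rewrite (comp2_linearr H) (comp2_linearl H) ev_linear.
Qed.

Lemma bracketDl X Y Z : b (X + Y) Z = b X Z + b Y Z.
Proof. exact: (linear_add (bracket_linearl Z)). Qed.

Lemma bracketZl a X Y : b (a *: X) Y = a * b X Y.
Proof. exact: (linear_scale (bracket_linearl Y)). Qed.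

Lemma bracketDr X Y Z : b X (Y + Z) = b X Y + b X Z.
Proof.
rewrite /b /bracket star2D (linear_add (comp2_linearl H X)).
rewrite (linear_add (tens2_linearr H _)) (linear_add (comp2_linearr H _)).
rewrite (linear_add (comp2_linearl H _)).
exact: evD.
Qed.

Lemma bracketZr a X Y : b X (a *: Y) = a^* * b X Y.
Proof.
rewrite /b /bracket star2Z (linear_scale (comp2_linearl H X)).
rewrite (linear_scale (tens2_linearr H _)) (linear_scale (comp2_linearr H _)).
rewrite (linear_scale (comp2_linearl H _)).
exact: evZ.
Qed.

Lemma bracket_ge0 X : 0 <= b X X.
Proof.
pose Y := (id2 (conj1 c) *** X) \c conjR c.
have -> : b X X = ev G (star2 Y \c Y) x.
  by rewrite (star2_comp H) /b /bracket -star_1tens !(comp2A H).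
exact: ev_star_ge0.
Qed.

(* The degenerate case of Cauchy-Schwarz. *)
Lemma bracket_null_add X Z : b Z Z = 0 -> b (X + Z) (X + Z) = b X X.
Proof.
move=> Z0; pose t := b X Z + b Z X.
have bE (a : R[i]) : a^* = a ->
    b (X + a *: Z) (X + a *: Z) = b X X + a * t.
  move=> ar; rewrite bracketDl !bracketDr.
  rewrite !bracketZl !bracketZr Z0 !mulr0 addr0 ar.
  by rewrite -addrA -mulrDr.
have := bE 1 (conjC1 _); rewrite scale1r mul1r => bXZ.
have treal : t \is Num.real.
  have -> : t = b (X + Z) (X + Z) - b X X by rewrite bXZ addrC addKr.
  by rewrite rpredB // ger0_real // bracket_ge0.
rewrite bXZ; have [->|t0] := eqVneq t 0; first by rewrite addr0.
(* For real a the form at X + a Z is affine in a with slope t. If t is nonzero, this a makes it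
   equal to -1, against positivity. *)
have ar : (- (b X X + 1) / t)^* = - (b X X + 1) / t.
  apply: conj_Creal; rewrite rpredM ?rpredV // rpredN rpredD ?rpred1 //.
  by rewrite ger0_real // bracket_ge0.
have e : b X X + - (b X X + 1) / t * t = -1 by rewrite divfK // opprD addNKr.
by have := bracket_ge0 (X + (- (b X X + 1) / t) *: Z); rewrite bE // e ler0N1.
Qed.

(** Equal classes put the constant sequence Y in the class of X, so the seminorm of X - Y is below
    every positive number. Conversely, adding a null vector does not change the seminorm, so both
    constants have the same class. *)
Lemma fibre_eqP X Y : fibre c x X = fibre c x Y <->
  b (X - Y) (X - Y) = 0.
Proof.
split=> [XY|XY].
  have p0 Z : 0 <= fibre_seminorm c x Z by rewrite sqrtC_ge0 bracket_ge0.
  pose p := @fibre_seminorm R K G A B r s c x.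
  have E : cauchy_class p (fun=> X) = cauchy_class p (fun=> Y).
    exact: (congr1 (@sep_class _ _ _) XY).
  have : cauchy_class p (fun=> X) (fun=> Y).
    rewrite E.
    split; first exact/cauchy_seq_cst/fibre_seminorm0.
    by move=> e e0; exists 0%N => n _; rewrite subrr /p fibre_seminorm0.
  case=> _ small; apply/eqP; rewrite -sqrtC_eq0; apply/negPn/negP => pN0.
  (* The bound is taken to be the seminorm of X - Y itself, which would then be smaller than
     itself. *)
  have /small [N /(_ N (leqnn N))] : 0 < p (X - Y) by rewrite lt_def pN0 p0.
  by rewrite ltxx.
rewrite /fibre /sep_image; move: (ex_intro2 _ _ _ _ _) (ex_intro2 _ _ _ _ _).
suff -> : cauchy_class (@fibre_seminorm R K G A B r s c x) (fun=> X) =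
          cauchy_class (@fibre_seminorm R K G A B r s c x) (fun=> Y).
  by move=> ? ?; congr SepCompletion; exact: Prop_irrelevance.
apply/seteqP; suff E v : fibre_seminorm c x (X - v) = fibre_seminorm c x (Y - v).
  by split=> v [vc vs]; split=> // e /vs[N NP]; exists N => n /NP; rewrite E.
congr sqrtC; have -> : X - v = (Y - v) + (X - Y).
  by rewrite [RHS]addrC addrA subrK.
exact: bracket_null_add.
Qed.

End Fibre.
End Gelfand.

(** The difference of the roots is at most their sum, and the product of the two is x - y. *)
Lemma sqrtC_dist (C : numClosedFieldType) (x y : C) : 0 <= x -> 0 <= y ->
  `|sqrtC x - sqrtC y| ^+ 2 <= `|x - y|.
Proof.
move=> x0 y0; rewrite -{2}(sqrtCK x) -{2}(sqrtCK y).
rewrite subr_sqr normrM expr2 ler_wpM2l //.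
rewrite [leRHS]ger0_norm ?addr_ge0 ?sqrtC_ge0 //.
by rewrite (le_trans (ler_normB _ _)) // !ger0_norm ?sqrtC_ge0.
Qed.

Lemma continuous_sqrtC (R : realType) (T : topologicalType)
    (f : T -> R[i]^o) : continuous f -> (forall x, 0 <= f x) ->
  continuous (fun x => sqrtC (f x) : R[i]^o).
Proof.
move=> fc f0 x; apply/cvgrPdist_lt => e e0.
have e20 : 0 < e ^+ 2 by rewrite exprn_gt0.
have /cvgrPdist_lt/(_ _ e20) := fc x; apply: filterS => y fxy.
rewrite -(ltr_pXn2r (n := 2)) ?nnegrE ?normr_ge0 ?(ltW e0) //.
exact: le_lt_trans (sqrtC_dist (f0 x) (f0 y)) fxy.
Qed.

(** * Norm estimates from the C*-identity *)

Section Norms.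
Context (R : realType) (K : cstar2cat R) (A B : obj K).
Let H := cstar2catP K.

(** From |Y|^2 = |Y^* Y| <= |Y^*| |Y| one gets |Y| <= |Y^*|; the same for the adjoint gives
    equality. *)
Lemma norm_star2 (r s : arr A B) (X : hom2 r s) : `|star2 X| = `|X|.
Proof.
suff le (t u : arr A B) (Y : hom2 t u) : `|Y| <= `|star2 Y|.
  by apply/le_anti; rewrite le -{2}(star2K H X) le.
have [->|Y0] := eqVneq `|Y| 0; first exact: normr_ge0.
rewrite -(ler_pM2r (x := `|Y|)) ?lt_def ?Y0 ?normr_ge0 // -expr2.
by rewrite -(norm_cstar H) (norm_comp2 H).
Qed.

(** |V|^2 is the norm of [id2 r], which equals its own square. Only an inequality holds, since
    [id2 r] may be 0. *)
Lemma norm_isometry_le1 (r s : arr A B) (V : hom2 r s) :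
  star2 V \c V = id2 r -> `|V| <= 1.
Proof.
move=> VV; have idE := norm_cstar H (id2 r).
rewrite star_id2 (comp2_1l H) in idE.
rewrite -(ler_pXn2r (n := 2)) ?nnegrE ?normr_ge0 ?ler01 // expr1n.
rewrite -(norm_cstar H) VV.
have [->|id0] := eqVneq `|id2 r| 0; first exact: ler01.
rewrite -(ler_pM2r (x := `|id2 r|)) ?lt_def ?id0 ?normr_ge0 //.
by rewrite -expr2 -idE mul1r.
Qed.
End Norms.

(** * Unital involutive representations of End(iota_A) on End(r), covering [ract] and [lact] at
    once *)

Section Representation.
Context (R : realType) (K : cstar2cat R) (G : gelfand K).
Context (A : obj K) (B C : obj K) (r s : arr B C).
Context (phi : hom2 (unit1 A) (unit1 A) -> hom2 r r).
Context (phi_lin : linear phi).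
Context (phiM : forall v w, phi (v \c w) = phi v \c phi w).
Context (phi1 : phi (id2 (unit1 A)) = id2 r).
Context (phiV : forall w, phi (star2 w) = star2 (phi w)).
Let H := cstar2catP K.

Lemma continuous_norm_sub (d : R[i]) (q : hom2 (unit1 A) (unit1 A)) :
  continuous (fun y => `|d - ev G q y| : R[i]^o).
Proof.
move=> y; apply: (@cvg_norm _ R[i]^o); apply: cvgB; first exact: cvg_cst.
exact: ev_continuous.
Qed.

(** u is min(q, d), written (d + q - |d - q|) / 2 so that its continuity is visible. *)
Lemma truncation (d : R[i]) (q : hom2 (unit1 A) (unit1 A)) :
    0 < d -> (forall x, 0 <= ev G q x) ->
  exists u, forall x, ev G u x = ev G q x /\ ev G q x <= d \/
                      ev G u x = d /\ d <= ev G q x.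
Proof.
move=> d0 q0.
have [|u uE] := ev_surj (g := G)
    (f := fun y => 2^-1 * (d + ev G q y - `|d - ev G q y|) : R[i]^o).
  move=> y; apply: cvgM; first exact: cvg_cst.
  apply: cvgB; last exact: continuous_norm_sub.
  by apply: cvgD; [exact: cvg_cst | exact: ev_continuous].
have half (a : R[i]) : 2^-1 * (a + a) = a.
  by rewrite mulrC mulrDl -splitr.
exists u => y; rewrite uE.
have rq : ev G q y \is Num.real by exact: ger0_real.
have rd : d \is Num.real by rewrite gtr0_real.
have [qd|/ltW dq] := real_leP rq rd; [left|right]; split=> //.
  by rewrite opprB (addrC d) addrACA subrr addr0 half.
by rewrite opprB addrACA subrr addr0 half.
Qed.

(* A real function bounded by 1 is the real part of the unitary
   u + i sqrt(1 - u^2). *)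
Lemma norm_rep_le1 u : (forall x, ev G u x \is Num.real) ->
  (forall x, `|ev G u x| <= 1) -> `|phi u| <= 1.
Proof.
move=> ur u1.
have u2 x : 0 <= 1 - ev G u x * ev G u x.
  by rewrite subr_ge0 -expr2 -real_normK ?ur // expr_le1.
have [|v vE] := ev_surj (g := G)
    (f := fun x => sqrtC (1 - ev G u x * ev G u x) : R[i]^o).
  apply: continuous_sqrtC => // x; apply: cvgB; first exact: cvg_cst.
  by apply: cvgM; exact: ev_continuous.
pose Z := u + 'i *: v; pose Z' := u - 'i *: v.
have uC : star2 u = u.
  by apply: (@ev_inj _ _ G) => x; rewrite ev_star conj_Creal.
have vC : star2 v = v.
  apply: (@ev_inj _ _ G) => x; rewrite ev_star conj_Creal // vE.
  by rewrite ger0_real // sqrtC_ge0.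
have ZZ' : star2 Z = Z'.
  by rewrite /Z star2D star2Z uC vC conjCi scaleNr.
have Z1 : star2 Z \c Z = id2 _.
  apply: (@ev_inj _ _ G) => x; rewrite ZZ' /Z' /Z ev_mul ev_one evB evD !evZ vE.
  rewrite -subr_sqr exprMn sqrCi sqrtCK mulN1r opprK expr2.
  by rewrite addrC subrK.
have Z'1 : star2 Z' \c Z' = id2 _.
  rewrite -ZZ' (star2K H); apply: (@ev_inj _ _ G) => x.
  by rewrite ev_mul mulrC -ev_mul Z1.
have nZ X : star2 X \c X = id2 _ -> `|phi X| <= 1.
  by move=> X1; apply: norm_isometry_le1; rewrite -phiV -phiM X1.
have -> : u = 2^-1 *: (Z + Z').
  have half : 2^-1 + 2^-1 = 1 :> R[i] by rewrite [RHS]splitr div1r.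
  by rewrite addrACA subrr addr0 scalerDr -scalerDl half scale1r.
rewrite (linear_scale phi_lin) (linear_add phi_lin) normrZ.
rewrite ger0_norm ?invr_ge0 ?ler0n// mulrC ler_pdivrMr ?ltr0n// mul1r.
by rewrite (le_trans (ler_normD _ _))// -[2]/(1 + 1) lerD ?nZ.
Qed.

Lemma norm_rep_le u (m : R[i]) : 0 < m -> (forall x, ev G u x \is Num.real) ->
  (forall x, `|ev G u x| <= m) -> `|phi u| <= m.
Proof.
move=> m0 ur um; have m0' : 0 <= m^-1 by rewrite invr_ge0 ltW.
have : `|phi (m^-1 *: u)| <= 1.
  apply: norm_rep_le1 => x; rewrite evZ.
    by rewrite rpredM ?ur // ger0_real.
  by rewrite normrM ger0_norm // mulrC ler_pdivrMr // mul1r.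
rewrite (linear_scale phi_lin) normrZ ger0_norm //.
by rewrite mulrC ler_pdivrMr // mul1r.
Qed.

(** For [ract], M is 1 \otimes R, L is the adjoint of \bar R tensored with 1, p is R^* R, and [LM]
    is a conjugation equation. For [lact], the adjoint equation is used and p is \bar R^* \bar R. *)
Context (p : hom2 (unit1 A) (unit1 A)) (L : hom2 s r) (M : hom2 r s).
Context (LM : L \c M = id2 r) (MM : star2 M \c M = phi p).

(** phi w = L (M phi w), and the C*-identity turns |M phi w|^2 into the norm of phi(w)^* M^* M
    phi(w), where M^* M = phi p. *)
Lemma norm_rep_sqr_le w :
  `|phi w| ^+ 2 <= `|L| ^+ 2 * `|phi (star2 w \c (p \c w))|.
Proof.
rewrite -{1}(comp2_1l H (phi w)) -LM -(comp2A H).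
have := norm_comp2 H L (M \c phi w).
rewrite -(ler_pXn2r (n := 2)) ?nnegrE ?mulr_ge0 ?normr_ge0 // exprMn.
rewrite -(norm_cstar H (M \c phi w)) (star2_comp H) -!(comp2A H).
by rewrite (comp2A H (star2 M)) MM -phiV -!phiM.
Qed.

Context (p_ge0 : forall x, 0 <= ev G p x).
Context (p_ker : forall w, phi w = 0 -> p \c w = 0).

(** Converse of [p_ker]: the kernel of phi is exactly the annihilator of p. *)
Lemma rep_eq0 w : p \c w = 0 -> phi w = 0.
Proof.
move=> pw; have := norm_rep_sqr_le w.
rewrite pw (linear_zero (comp2_linearr H _)) (linear_zero phi_lin) normr0 mulr0.
by rewrite real_exprn_even_le0 ?normr_real //= normr_eq0 => /eqP.
Qed.

(* If w is supported where p < d, then p w = u w with u = min(p, d), and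
   norm_rep_sqr_le gives |phi w|^2 <= |L|^2 d |phi w|^2; so phi w = 0 once
   |L|^2 d < 1, and p >= d wherever all of ker phi vanishes. *)
Lemma rep_gap : exists2 d, 0 < d &
  forall x, (forall w, phi w = 0 -> ev G w x = 0) -> d <= ev G p x.
Proof.
(* This makes |L|^2 d < 1; the summand 1 keeps the inverse meaningful when L = 0. *)
pose d : R[i] := (2 * (1 + `|L| ^+ 2))^-1.
have L0 : 0 <= `|L| ^+ 2 by rewrite exprn_ge0.
have L1 : 0 < 1 + `|L| ^+ 2 by rewrite ltr_pwDl.
have d0 : 0 < d by rewrite invr_gt0 mulr_gt0 ?ltr0n.
(* w is twice the positive part of d - p, so it vanishes exactly where p >= d. *)
have [|w wE] := ev_surj (g := G)
    (f := fun y => `|d - ev G p y| + (d - ev G p y) : R[i]^o).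
  move=> y; apply: cvgD; first exact: continuous_norm_sub.
  by apply: cvgB; [exact: cvg_cst | exact: ev_continuous].
have [u uP] := truncation d0 p_ge0.
have w_eq0 y : d <= ev G p y -> ev G w y = 0.
  by move=> dp; rewrite wE ler0_norm ?subr_le0 // addNr.
have uw : p \c w = u \c w.
  apply: (@ev_inj _ _ G) => y; rewrite !ev_mul.
  by case: (uP y) => [[-> _]|[_ /w_eq0 ->]]; rewrite ?mulr0.
have ud : `|phi u| <= d.
  apply: norm_rep_le => // y; case: (uP y) => [[-> pd]|[-> _]].
  - exact: ger0_real.
  - exact: gtr0_real.
  - by rewrite ger0_norm.
  - by rewrite gtr0_norm.
suff w0 : phi w = 0.
  exists d => // x /(_ w w0); rewrite wE => wx.
  have rp : ev G p x \is Num.real by exact: ger0_real.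
  have rd : d \is Num.real by rewrite gtr0_real.
  have [//|pd] := real_leP rd rp.
  move/eqP: wx; rewrite gtr0_norm ?subr_gt0 // gt_eqF //.
  by rewrite addr_gt0 ?subr_gt0.
apply/eqP; rewrite -normr_eq0; apply/negPn/negP => w0.
have w0' : 0 < `|phi w| by rewrite lt_def w0 normr_ge0.
have : `|phi w| ^+ 2 <= `|L| ^+ 2 * (`|phi w| * (d * `|phi w|)).
  apply: le_trans (norm_rep_sqr_le w) _; rewrite ler_wpM2l //.
  rewrite uw phiM phiV (le_trans (norm_comp2 H _ _)) //.
  rewrite norm_star2 ler_wpM2l // phiM (le_trans (norm_comp2 H _ _)) //.
  by rewrite ler_wpM2r.
rewrite expr2 mulrCA ler_pM2l // mulrA -{1}[`|phi w|]mul1r ler_pM2r //.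
rewrite /d ler_pdivlMr ?mulr_gt0 ?ltr0n // mul1r => le.
have := le_trans le (_ : _ <= 1 + `|L| ^+ 2).
rewrite lerDr ler01 => /(_ isT).
by rewrite ger_pMl // lern1.
Qed.

(** [rep_gap] keeps p away from 0 on the common zeros of the kernel; conversely p w = 0 forces w(x)
    = 0 wherever p(x) is nonzero. *)
Lemma zeros_ker_neq0 x :
  (forall w, phi w = 0 -> ev G w x = 0) <-> ev G p x != 0.
Proof.
split=> [kx|px w /p_ker pw].
  by have [d d0 /(_ x kx) dp] := rep_gap; rewrite gt_eqF // (lt_le_trans d0).
have := congr1 (fun v => ev G v x) pw; rewrite ev_mul => /eqP.
rewrite (linear_zero (@ev_is_linear _ _ G A x)) mulf_eq0 (negPf px) /=.
by move/eqP.
Qed.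

Lemma rep_eq0_on w :
  (forall x, (forall v, phi v = 0 -> ev G v x = 0) -> ev G w x = 0) ->
  phi w = 0.
Proof.
move=> w0; apply: rep_eq0; apply: (@ev_inj _ _ G) => x.
rewrite ev_mul (linear_zero (@ev_is_linear _ _ G A x)).
have [->|/zeros_ker_neq0/w0 ->] := eqVneq (ev G p x) 0; first exact: mul0r.
exact: mulr0.
Qed.

(** e = min(p, d) / d is the indicator function of the common zero set of the kernel: p >= d on that
    set by [rep_gap], and p = 0 off it. *)
Lemma rep_cutoff : exists2 e, phi e = id2 r &
  forall x, ~ (forall v, phi v = 0 -> ev G v x = 0) -> ev G e x = 0.
Proof.
have [d d0 gap] := rep_gap; have [u uP] := truncation d0 p_ge0.
have dN0 : d != 0 by rewrite gt_eqF.
exists (d^-1 *: u) => [|x /zeros_ker_neq0/negP/negPn/eqP px0].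
  apply/eqP; rewrite -phi1 -subr_eq0 -(linear_sub phi_lin); apply/eqP.
  apply: rep_eq0_on => x /gap dp; rewrite evB evZ ev_one.
  case: (uP x) => [[-> pd]|[-> _]]; last by rewrite mulVf ?subrr.
  by have -> : ev G p x = d; [exact/le_anti/andP | rewrite mulVf ?subrr].
rewrite evZ; case: (uP x) => [[-> _]|[_]]; first by rewrite px0 mulr0.
by move/(lt_le_trans d0); rewrite px0 ltxx.
Qed.
End Representation.

(** * The central actions as representations, their supports, and [theta] *)

Section CentralActions.
Context (R : realType) (K : cstar2cat R) (G : gelfand K).
Context (A B : obj K) (r : arr A B) (c : conj_data r).
Let H := cstar2catP K.

Lemma balanced_lact z : centrally_balanced r ->
  exists w, lact r z = ract r w.
Proof.
move=> rb; have : range (ract r) (lact r z) by rewrite -rb; exists z.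
by case=> w _ <-; exists w.
Qed.

Lemma cast2_linear (s s' t t' : arr A B) (es : s = s') (et : t = t') :
  linear (@cast2 R K A B s s' t t' es et).
Proof. by case: _ / es; case: _ / et. Qed.

Lemma lact_linear : linear (lact r).
Proof. by move=> a v w; rewrite /lact (tens2_linearl H) cast2_linear. Qed.

Lemma ract_linear : linear (ract r).
Proof. by move=> a v w; rewrite /ract (tens2_linearr H) cast2_linear. Qed.

Lemma lactM v w : lact r (v \c w) = lact r v \c lact r w.
Proof.
apply: heq_eq; apply: heq_trans (lact_heq _ _) _.
rewrite -{1}(comp2_1l H (id2 r)) (Defs.interchange H).
by apply/heq_sym/heq_comp; exact: lact_heq.
Qed.

Lemma ractM v w : ract r (v \c w) = ract r v \c ract r w.
Proof.
apply: heq_eq; apply: heq_trans (ract_heq _ _) _.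
rewrite -{1}(comp2_1l H (id2 r)) (Defs.interchange H).
by apply/heq_sym/heq_comp; exact: ract_heq.
Qed.

Lemma lact1 : lact r (id2 (unit1 B)) = id2 r.
Proof. by apply: heq_eq; apply: heq_trans (lact_heq _ _) (heq_1tens _). Qed.

Lemma ract1 : ract r (id2 (unit1 A)) = id2 r.
Proof. by apply: heq_eq; apply: heq_trans (ract_heq _ _) (heq_tens1 _). Qed.

Lemma lact_star w : lact r (star2 w) = star2 (lact r w).
Proof.
apply: heq_eq; apply: heq_trans (lact_heq _ _) _.
rewrite -{1}(star_id2 r) -(star2_tens H).
exact/heq_star/heq_sym/lact_heq.
Qed.

Lemma ract_star w : ract r (star2 w) = star2 (ract r w).
Proof.
apply: heq_eq; apply: heq_trans (ract_heq _ _) _.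
rewrite -{1}(star_id2 r) -(star2_tens H).
exact/heq_star/heq_sym/ract_heq.
Qed.

(** Sliding w through R turns R w into (1 \otimes [ract r w]) R, which is 0. *)
Lemma ract_ker w : ract r w = 0 -> star2 (conjR c) \c conjR c \c w = 0.
Proof.
move=> w0; rewrite -(comp2A H) -(ract_unit w) -ract_nat ract_tens w0.
rewrite (linear_zero (tens2_linearr H _)) (linear_zero (comp2_linearl H _)).
by rewrite (linear_zero (comp2_linearr H _)).
Qed.

Lemma lact_ker z : lact r z = 0 -> star2 (conjRbar c) \c conjRbar c \c z = 0.
Proof.
move=> z0; rewrite -(comp2A H) -(lact_unit z) -lact_nat lact_tens z0.
rewrite (linear_zero (tens2_linearl H _)) (linear_zero (comp2_linearl H _)).
by rewrite (linear_zero (comp2_linearr H _)).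
Qed.

Context (c_sol : conj_solution c).

Lemma ract_retract : exists s (L : hom2 s r) (M : hom2 r s),
  L \c M = id2 r /\ star2 M \c M = ract r (star2 (conjR c) \c conjR c).
Proof.
have [LM _] := c_sol; do 3!eexists; split; first exact: LM.
have M1 := heq_cast (unit1r r) erefl (heq_refl (id2 r *** conjR c)).
apply: heq_eq; apply: heq_trans (heq_comp (heq_star M1) M1) _.
by rewrite star_1tens; exact/heq_sym/ract_heq.
Qed.

Lemma lact_retract : exists s (L : hom2 s r) (M : hom2 r s),
  L \c M = id2 r /\ star2 M \c M = lact r (star2 (conjRbar c) \c conjRbar c).
Proof.
(* Taking adjoints swaps the two factors, so that \bar R \otimes 1 becomes the one with a left
   inverse. *)
have [/(congr1 star2) + _] := c_sol; rewrite (star2_comp H) star_id2 => LM.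
do 3!eexists; split; first exact: LM.
have M1 := heq_cast (esym (tens1A r (conj1 c) r)) (unit1l r)
  (heq_refl (star2 (conjRbar c) *** id2 r)).
rewrite (star2K H); apply: heq_eq.
apply: heq_trans (heq_comp M1 (heq_star M1)) _.
rewrite (star2_tens H) (star2K H) star_id2 -(Defs.interchange H) (comp2_1l H).
exact/heq_sym/lact_heq.
Qed.

Lemma Sl_neq0 x : Sl G r x -> ev G (star2 (conjR c) \c conjR c) x != 0.
Proof.
have [s [L [M [LM MM]]]] := ract_retract.
move=> Sx; apply/(zeros_ker_neq0 ract_linear ractM ract1 ract_star LM MM) => //.
  by move=> y; exact: ev_star_ge0.
exact: ract_ker.
Qed.

Lemma Sl_cutoff : exists2 e, ract r e = id2 r & supported (Sl G r) e.
Proof.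
have [s [L [M [LM MM]]]] := ract_retract.
apply: (rep_cutoff ract_linear ractM ract1 ract_star LM MM).
  by move=> y; exact: ev_star_ge0.
exact: ract_ker.
Qed.

Lemma Sr_cutoff : exists2 e, lact r e = id2 r & supported (Sr G r) e.
Proof.
have [s [L [M [LM MM]]]] := lact_retract.
apply: (rep_cutoff lact_linear lactM lact1 lact_star LM MM).
  by move=> y; exact: ev_star_ge0.
exact: lact_ker.
Qed.

(** The defining property of [h] concerns only supported functions. Multiplying w and z by the
    indicators e and f of the two supports changes neither their actions nor their values there. *)
Lemma theta_inv_starE (h : Sl G r -> Sr G r) z w : is_theta_inv_star h ->
  lact r z = ract r w ->
  forall x : Sl G r, ev G z (val (h x)) = ev G w (val x).
Proof.
case=> _ _ hE zw x.
have [e e1 eS] := Sl_cutoff; have [f f1 fS] := Sr_cutoff.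
have weS : supported (Sl G r) (w \c e).
  by move=> y /eS ey; rewrite ev_mul ey mulr0.
(* 1 - e acts as 0, so it vanishes on S_l. *)
have ex : ev G e (val x) = 1.
  have /set_mem/(_ (id2 _ - e)) := valP x.
  rewrite (linear_sub ract_linear) e1 ract1 subrr => /(_ erefl)/eqP.
  by rewrite evB ev_one subr_eq0 => /eqP.
have : [set z' | supported (Sr G r) z' /\ lact r z' = ract r (w \c e)]
    (theta G r (w \c e)).
  (* The witness z f shows that [theta] does not take its default value 0 here. *)
  apply: (@xgetPex _ 0); exists (z \c f); split.
    by move=> y /fS fy; rewrite ev_mul fy mulr0.
  by rewrite lactM ractM e1 f1 zw.
case=> _; rewrite ractM e1 (comp2_1r H) -zw => tz.
(* [theta G r (w \c e)] and z have the same left action, hence agree on S_r, in particular at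
   [h x]. *)
have /set_mem/(_ (theta G r (w \c e) - z)) := valP (h x).
rewrite (linear_sub lact_linear) tz subrr => /(_ erefl)/eqP.
rewrite evB subr_eq0 => /eqP <-.
by rewrite hE // ev_mul ex mulr1.
Qed.
End CentralActions.

Theorem proposition2p22 (R : realType) (K : cstar2cat R) (G : gelfand K)
  (K_proj : projections_split K) (K_sum : direct_sums_exist K)
  (K_conj : conjugates_exist K)
  (A B C D : obj K)
  (rho : arr A B) (rho' sigma' : arr B C) (rho'' : arr C D)
  (rho_cb : centrally_balanced rho) (rho'_cb : centrally_balanced rho')
  (sigma'_cb : centrally_balanced sigma')
  (rho''_cb : centrally_balanced rho'')
  (c : conj_data rho) (c' : conj_data rho') (c'' : conj_data rho'')
  (c_sol : conj_solution c) (c'_sol : conj_solution c')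
  (c''_sol : conj_solution c'')
  (h : Sl G rho -> Sr G rho) (h_theta : is_theta_inv_star h)
  (h' : Sl G rho' -> Sr G rho') (h'_theta : is_theta_inv_star h')
  (T T' : hom2 rho' sigma') :
  (forall omega : Sl G rho, Sl G rho' (val (h omega)) ->
     fibre (conj_prod c' c) (val omega) (T *** id2 rho)
       = fibre (conj_prod c' c) (val omega) (T' *** id2 rho)
     <-> fibre c' (val (h omega)) T = fibre c' (val (h omega)) T')
  /\
  (forall alpha : Sl G rho', Sl G rho'' (val (h' alpha)) ->
     fibre (conj_prod c'' c') (val alpha) (id2 rho'' *** T)
       = fibre (conj_prod c'' c') (val alpha) (id2 rho'' *** T')
     <-> fibre c' (val alpha) T = fibre c' (val alpha) T').
Proof.
have H := cstar2catP K.
have mul_eq0 A0 (v w : hom2 (unit1 A0) (unit1 A0)) (x : Omega G A0) :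
    ev G v x != 0 -> ev G (v \c w) x = 0 <-> ev G w x = 0.
  move=> v0; rewrite ev_mul; split=> [/eqP|->]; last by rewrite mulr0.
  by rewrite mulf_eq0 (negPf v0) => /eqP.
split=> [omega _|alpha Salpha].
- rewrite !fibre_eqP -(linear_sub (tens2_linearl H (id2 rho))).
  rewrite !bracketE star_tens1 ctrace_prod.
  (* By linearity only the form at T - T' matters; central balance moves this scalar from the left
     of rho to its right. *)
  have [w zw] := balanced_lact (ctrace c' (star2 (T - T') \c (T - T'))) rho_cb.
  rewrite (theta_inv_starE c_sol h_theta zw) zw (comp2_1r H).
  rewrite -(comp2_1l H (ract _ _)) ctrace_ract ctrace_id.
  exact/mul_eq0/Sl_neq0/set_mem/valP.
- rewrite !fibre_eqP -(linear_sub (tens2_linearr H (id2 rho''))).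
  rewrite !bracketE star_1tens ctrace_prod ctrace_id.
  have [w zw] := balanced_lact (star2 (conjR c'') \c conjR c'') rho'_cb.
  (* The scalar coming from rho'' is moved across rho' and leaves the trace as the factor w. *)
  rewrite lact_nat zw ctrace_ract.
  (* R''^* R'' is nonzero at [h' alpha], and its value there is w(alpha). *)
  have := Sl_neq0 c''_sol Salpha.
  rewrite (theta_inv_starE c'_sol h'_theta zw) => w0.
  by rewrite ev_mul mulrC -ev_mul; exact: mul_eq0.
Qed.
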